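(* Let $G$ be a graph satisfying the NC property. Then $\chi_{DP}(G)\le \omega(G)+1$. Moreover, if $G$ is $K_n$-minor-free, then $\chi_{DP}(G)\le n-1$.
   Context: All graphs are finite and simple. $\omega(G)$ is the clique number and $\chi_{DP}(G)$ the DP-chromatic (correspondence chromatic) number of $G$. A hole of $G$ is an induced cycle of length at least $4$; $G$ is chordal if it has no hole. $\mathcal H(G)$ denotes the set of holes of $G$ and $\mathcal H(G,u)$ the set of holes of $G$ containing the vertex $u$. A hole cover of $G$ is a nonempty set $X\subseteq V(G)$ such that every hole of $G$ contains a vertex of $X$ (if $G$ is chordal, every nonempty vertex set is a hole cover). A vertex $u$ satisfies the NC property in $G$ if there are no holes $H\in\mathcal H(G,u)$ and $H'\in\mathcal H(G)\setminus\mathcal H(G,u)$ sharing two consecutive edges, i.e. two distinct edges with a common end vertex that both lie on $H$ and on $H'$. A set $\mathcal C\subseteq V(G)$ satisfies the NC property in $G$ if every vertex of $\mathcal C$ satisfies the NC property in $G$ and every hole of $G$ contains at most one vertex of $\mathcal C$. A graph satisfies the NC property if it has a hole cover satisfying the NC property in it. *)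

(* Defs.v *)
From HB Require Import structures.
From mathcomp Require Import all_boot.
Set Implicit Arguments. Unset Strict Implicit. Unset Printing Implicit Defensive.

Section Graphs.
Variables (T : finType) (e : rel T).

Definition simple_graph : Prop := symmetric e /\ irreflexive e.

Definition is_hole (H : {set T}) : Prop :=
  exists c : seq T,
    [/\ uniq c, 4 <= size c, cycle e c,
        {in c &, forall x y, e x y -> (y == next c x) || (y == prev c x)}
      & H = [set x in c]].

(* Holes H and H' share two consecutive edges xy, yz (x != z); since holes
   are induced, an edge lies on a hole iff both its ends are in it. *)
Definition share_two_consecutive_edges (H H' : {set T}) : Prop :=
  exists x y z : T, [/\ x != z, e x y, e y z,
    [&& x \in H, y \in H & z \in H] & [&& x \in H', y \in H' & z \in H']].

Definition NC_vertex (u : T) : Prop :=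
  ~ exists H H' : {set T}, [/\ is_hole H, is_hole H', u \in H, u \notin H'
                               & share_two_consecutive_edges H H'].

Definition hole_cover (X : {set T}) : Prop :=
  X != set0 /\ forall H, is_hole H -> H :&: X != set0.

Definition NC_set (C : {set T}) : Prop :=
  (forall u, u \in C -> NC_vertex u) /\
  (forall H, is_hole H -> #|H :&: C| <= 1).

Definition NC_graph : Prop := exists X : {set T}, hole_cover X /\ NC_set X.

Definition is_clique (K : {set T}) : bool :=
  [forall x in K, forall y in K, (x != y) ==> e x y].

Definition omega : nat := \max_(K : {set T} | is_clique K) #|K|.

(* DP-colouring.  A k-correspondence assignment assigns to every edge uv a
   matching M u v between {u} x [k] and {v} x [k] (M u v i j means (u,i) and
   (v,j) are adjacent in the cover graph). *)
Definition correspondence (k : nat) (M : T -> T -> 'I_k -> 'I_k -> bool) : Prop :=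
  (forall u v i j, M u v i j = M v u j i) /\
  (forall u v i j j', e u v -> M u v i j -> M u v i j' -> j = j').

Definition DP_colorable (k : nat) : Prop :=
  forall M : T -> T -> 'I_k -> 'I_k -> bool, correspondence M ->
    exists f : T -> 'I_k, forall u v, e u v -> ~~ M u v (f u) (f v).

Definition chi_DP_le (m : nat) : Prop := exists2 k, k <= m & DP_colorable k.

(* K_n minor via branch sets: n pairwise disjoint nonempty vertex sets, each
   inducing a connected subgraph, pairwise joined by an edge. *)
Definition induced_connected (B : {set T}) : Prop :=
  {in B &, forall x y, connect [rel a b | [&& a \in B, b \in B & e a b]] x y}.

Definition has_K_minor (n : nat) : Prop :=
  exists B : 'I_n -> {set T},
    [/\ forall i, B i != set0,
        forall i, induced_connected (B i),
        forall i j, i != j -> [disjoint B i & B j]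
      & forall i j, i != j -> exists x y, [/\ x \in B i, y \in B j & e x y]].

End Graphs.

(* Main.v *)
Require Import Defs.
From mathcomp Require Import all_boot.
From mathcomp Require Import zify.
Set Implicit Arguments. Unset Strict Implicit. Unset Printing Implicit Defensive.

(** Let X be the hole cover.  Join each u in X to every vertex lying on a hole
    through u.  Doing this for one u satisfying the NC property destroys the holes
    through u and creates none: a hole of the new graph through u would, together
    with the holes responsible for the new edges at u, either contain a vertex that
    was already on a common hole with u, or produce a hole avoiding u that follows
    two consecutive edges of a hole through u.  Processing all of X yields a chordal
    supergraph f of G.  A clique K of f has a vertex u such that K minus u is a
    clique of G, so it has at most omega + 1 vertices; moreover, every vertex of K
    not adjacent to u shares a hole with u, so the component of u in G - (K minus u),
    with the other vertices of K as singletons, gives a complete minor on #|K|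
    vertices.  Finally a chordal graph has simplicial vertices, and colouring G
    greedily along an elimination order of f needs only the clique number of f. *)

(** * Cyclic neighbours in duplicate-free sequences *)

Lemma next_nth_uniq (T : finType) (x0 : T) (c : seq T) i : uniq c -> i < size c ->
  next c (nth x0 c i) = nth x0 c (if i.+1 == size c then 0 else i.+1).
Proof.
move=> Uc ic; rewrite next_nth mem_nth // index_uniq //.
case: c Uc ic => [|y s] //= _ ic; rewrite eqSS.
have [->|ne] := eqVneq i (size s); first by rewrite nth_default.
by apply: set_nth_default; lia.
Qed.

Lemma prev_nth_uniq (T : finType) (x0 : T) (c : seq T) i : uniq c -> i < size c ->
  prev c (nth x0 c i) = nth x0 c (if i == 0 then (size c).-1 else i.-1).
Proof.
move=> Uc ic; rewrite prev_nth mem_nth //.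
case: c Uc ic => [|y s] //= /andP[ys Us] ic.
case: i ic => [|i] /= ic.
  by rewrite memNindex //; apply: set_nth_default.
by rewrite index_uniq //; apply: set_nth_default => /=; lia.
Qed.

Lemma nth_eq_uniq (T : finType) (x0 : T) (c : seq T) i j :
  i < size c -> j < size c -> uniq c -> (nth x0 c i == nth x0 c j) = (i == j).
Proof. exact: nth_uniq. Qed.

Lemma mem_nthP (T : finType) (x0 : T) (c : seq T) x :
  reflect (exists2 i, i < size c & nth x0 c i = x) (x \in c).
Proof. exact: nthP. Qed.

(** * Holes as vertex sequences *)

Section HoleSeq.
Variables (T : finType) (e : rel T).

Definition hole_seq (c : seq T) : bool :=
  [&& uniq c, 4 <= size c, cycle e c &
      all (fun x => all (fun y => e x y ==> (y == next c x) || (y == prev c x)) c) c].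

Lemma is_holeP (H : {set T}) :
  is_hole e H <-> exists2 c, hole_seq c & H = [set x in c].
Proof.
split=> [[c [Uc sc cc chord ->]]|[c /and4P[Uc sc cc chord] ->]]; exists c => //.
  apply/and4P; split=> //; apply/allP => x xc; apply/allP => y yc.
  by apply/implyP; apply: chord.
split=> // x y xc yc exy.
by move/allP: chord => /(_ _ xc) /allP /(_ _ yc) /implyP; apply.
Qed.

Lemma hole_seq_rot n c : hole_seq c -> hole_seq (rot n c).
Proof.
case/and4P=> Uc sc cc chord; rewrite /hole_seq rot_uniq size_rot rot_cycle Uc sc cc /=.
rewrite (eq_all_r (mem_rot n c)); apply: sub_all chord => x.
rewrite (eq_all_r (mem_rot n c)); apply: sub_all => y.
by rewrite next_rot // prev_rot.
Qed.

(** Kept boolean so that [fill] can be a [rel]. The length bound [#|T|] loses nothing, since a hole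
    repeats no vertex. *)
Definition common_hole (x y : T) : bool :=
  [exists H : {set T}, [exists n : 'I_#|T|.+1, [exists t : n.-tuple T,
     hole_seq t && (H == [set x in t])]] && (x \in H) && (y \in H)].

Lemma common_holeP x y :
  reflect (exists2 H, is_hole e H & (x \in H) && (y \in H)) (common_hole x y).
Proof.
apply: (iffP existsP) => -[H].
  case/andP=> /andP[/existsP[n /existsP[t /andP[ht /eqP ->]]] xH yH].
  exists [set x in t]; last by rewrite xH.
  by apply/is_holeP; exists t.
case/is_holeP => c hc defH /andP[xH yH]; exists H; rewrite xH yH !andbT.
have Uc : uniq c by case/and4P: hc.
have sc : size c < #|T|.+1 by rewrite ltnS -(card_uniqP Uc) max_card.
apply/existsP; exists (Ordinal sc); apply/existsP; exists (in_tuple c).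
by rewrite hc defH eqxx.
Qed.

Hypotheses (e_sym : symmetric e) (e_irr : irreflexive e).

(* A hole as a function on indices, so that arcs of the cycle become intervals. *)
Lemma hole_seq_nthP x0 c :
  hole_seq c <->
  [/\ uniq c, 4 <= size c & forall i j, i < j < size c ->
     e (nth x0 c i) (nth x0 c j) = (j == i.+1) || ((i == 0) && (j == (size c).-1))].
Proof.
split=> [/and4P[Uc sc cc chord]|[Uc sc adj]].
  split=> // i j /andP[ij jc]; have ic : i < size c by lia.
  apply/idP/idP => [eij|].
    move/allP: chord => /(_ _ (mem_nth x0 ic)) /allP /(_ _ (mem_nth x0 jc)).
    rewrite eij /= next_nth_uniq // prev_nth_uniq //.
    case: ifP => i1; case: ifP => i0; rewrite !nth_eq_uniq //; lia.
  case/orP => [/eqP ->|/andP[/eqP -> /eqP ->]].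
    have := next_cycle cc (mem_nth x0 ic); rewrite next_nth_uniq //.
    by case: ifP => //; lia.
  have jc' : (size c).-1 < size c by lia.
  have := next_cycle cc (mem_nth x0 jc'); rewrite next_nth_uniq //.
  by rewrite prednK ?eqxx 1?e_sym //; lia.
apply/and4P; split=> //.
  apply: cycle_from_next => // x /(mem_nthP x0)[i ic <-]; rewrite next_nth_uniq //.
  case: ifP => [/eqP i1|i1]; last by rewrite adj; lia.
  by rewrite e_sym adj; lia.
apply/allP => x /(mem_nthP x0)[i ic <-]; apply/allP => y /(mem_nthP x0)[j jc <-].
apply/implyP; rewrite next_nth_uniq // prev_nth_uniq //.
case: (ltngtP i j) => [ij|ji|->].
- by rewrite adj ?ij //; case: ifP => i1; case: ifP => i0; rewrite !nth_eq_uniq //; lia.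
- by rewrite e_sym adj ?ji //; case: ifP => i1; case: ifP => i0; rewrite !nth_eq_uniq //; lia.
- by rewrite e_irr.
Qed.

End HoleSeq.

(** A walk of minimal length works, because a forward edge that skips a vertex would shorten it.
    [hole_through] builds holes from such paths. *)
Lemma shortest_path (T : finType) (r : rel T) x y : connect r x y ->
  exists p, [/\ path r x p, last x p = y, uniq (x :: p) &
    forall i j, i < j < (size p).+1 ->
      r (nth x (x :: p) i) (nth x (x :: p) j) -> j = i.+1].
Proof.
move=> xy.
pose P n := [exists t : n.-tuple T, path r x t && (last x t == y)].
have exP : exists n, P n.
  case/connectP: xy => p pp lp; exists (size p).
  by apply/existsP; exists (in_tuple p); rewrite pp /= lp.
case: (ex_minnP exP) => n /existsP[t /andP[]]; case/shortenP => p pp Up sub /eqP lp min.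
have minq q : path r x q -> last x q = y -> size p <= size q.
  move=> pq lq; have /min : P (size q).
    by apply/existsP; exists (in_tuple q); rewrite /= pq lq eqxx.
  apply: leq_trans; rewrite -(size_tuple t); apply: uniq_leq_size => //.
  by move: Up; rewrite cons_uniq => /andP[].
exists p; split=> // i [|j] // /andP[ij jp] rij.
apply/eqP; rewrite eqn_leq ij andbT leqNgt; apply/negP => ltij.
have sj : j < size p := jp.
have si : i <= size p by lia.
have defi : nth x (x :: p) i = last x (take i p).
  by rewrite (last_nth x) size_takel //; case: (i) si => //= k sk; rewrite nth_take.
(* Position [j.+1] of [x :: p] is entry [j] of [p], so this walk follows the edge from position [i]
   to position [j.+1] and saves [j - i] steps. *)
have := minq (take i p ++ drop j p).
rewrite cat_path last_cat (drop_nth x) //= -defi rij.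
move: (pp); rewrite -{1}(cat_take_drop i p) cat_path => /andP[-> _] /=.
move: (pp); rewrite -{1}(cat_take_drop j.+1 p) cat_path => /andP[_].
rewrite (take_nth x) // last_rcons => -> /(_ isT).
have -> : last (nth x p j) (drop j.+1 p) = y.
  by move: lp; rewrite -{1}(cat_take_drop j.+1 p) last_cat (take_nth x) // last_rcons.
by move=> /(_ erefl); rewrite size_cat /= size_drop size_takel //; lia.
Qed.

(** * Connectivity in induced subgraphs and the construction of holes *)

Section Connectivity.
Variables (T : finType) (e : rel T).
Hypotheses (e_sym : symmetric e) (e_irr : irreflexive e).

Definition induced_rel (S : {set T}) : rel T :=
  [rel a b | [&& a \in S, b \in S & e a b]].

Lemma induced_rel_csym S : connect_sym (induced_rel S).
Proof.
by apply: sym_connect_sym => x y; rewrite /induced_rel /= e_sym; case: (x \in S); case: (y \in S).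
Qed.

Lemma connect_induced_subset (S S' : {set T}) x y : S \subset S' ->
  connect (induced_rel S) x y -> connect (induced_rel S') x y.
Proof.
move=> /subsetP SS'; apply: connect_sub => a b /and3P[aS bS eab].
by apply: connect1; rewrite /induced_rel /= !SS'.
Qed.

Lemma induced_connected1 x : induced_connected e [set x].
Proof. by move=> a b /set1P -> /set1P ->; apply: connect0. Qed.

Lemma induced_connectedU (A B : {set T}) a b :
  induced_connected e A -> induced_connected e B ->
  a \in A -> b \in B -> (a == b) || e a b -> induced_connected e (A :|: B).
Proof.
move=> cA cB aA bB ab.
have ca x : x \in A :|: B -> connect (induced_rel (A :|: B)) x a.
  case/setUP => [xA|xB].
    exact: connect_induced_subset (subsetUl _ _) (cA _ _ xA aA).
  apply: connect_trans (connect_induced_subset (subsetUr _ _) (cB _ _ xB bB)) _.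
  case/predU1P: ab => [->|eab]; first exact: connect0.
  by apply: connect1; rewrite /induced_rel /= !inE aA bB orbT e_sym eab.
move=> x y /ca xa /ca; rewrite induced_rel_csym; exact: connect_trans.
Qed.

Lemma connect_pathset x p (S : {set T}) y : path e x p -> last x p = y ->
  {subset x :: p <= S} -> connect (induced_rel S) x y.
Proof.
elim: p x => [|z p IH] x /= => [_ <- _|/andP[exz pp] lp sub]; first exact: connect0.
apply: (@connect_trans _ _ z).
  by apply: connect1; rewrite /induced_rel /= exz !sub ?inE ?eqxx ?orbT.
by apply: IH => // w wp; apply: sub; rewrite inE wp orbT.
Qed.

(** Close a shortest path from [a] to [b] in [S] through [c]: no chord starts at [c], whose
    neighbours in [S] are among [a] and [b], and nonadjacency of [a] and [b] gives length at least
    4. The last conclusion serves to show that the hole must pass through a given separator of [a]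
    and [b]. *)
Lemma hole_through c a b (S : {set T}) :
  e c a -> e c b -> a != b -> ~~ e a b -> c \notin S ->
  {in S, forall y, e c y -> (y == a) || (y == b)} ->
  connect (induced_rel S) a b ->
  exists H, [/\ is_hole e H, [&& c \in H, a \in H & b \in H], H \subset c |: S
              & connect (induced_rel (H :\ c)) a b].
Proof.
move=> eca ecb ab nab cS onlyab /shortest_path[p [pp lp Up ind]].
have pS : {subset a :: p <= S}.
  have aS : a \in S.
    case: p pp lp {Up ind} => [|z p] /=; first by move=> _ E; rewrite E eqxx in ab.
    by case/andP => /and3P[].
  move=> z; rewrite inE => /predU1P[-> //|].
  elim: p a pp aS {Up ind lp eca nab onlyab ab} => //= w p IH x.
  case/andP=> /and3P[_ wS _] pp _; rewrite inE => /predU1P[-> //|].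
  exact: IH pp wS.
have pe : path e a p by apply: sub_path pp => x y /and3P[].
have bp : b \in a :: p by rewrite -lp mem_last.
have sp : 2 <= size p.
  case: p pp lp {Up ind pS pe bp} => [|z [|w p]] //=.
    by move=> _ E; rewrite E eqxx in ab.
  by rewrite andbT => /and3P[_ _ eaz] E; rewrite -E eaz in nab.
have cp : c \notin a :: p by apply: contra cS => /pS.
have nb : nth a (a :: p) (size p) = b by rewrite -lp (last_nth a).
exists [set x in c :: a :: p]; split.
- apply/is_holeP; exists (c :: a :: p) => //.
  apply/(hole_seq_nthP e_sym e_irr a); split=> //=; first by rewrite cp.
  move=> [|i] [|j] // /andP[ij jp] /=.
    case: j jp {ij} => [|j] jp /=; first by rewrite eca.
    have pj : nth a p j \in S by apply: pS; rewrite inE mem_nth ?orbT.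
    rewrite !eqSS; have [Ej|nj] := eqVneq j.+1 (size p).
      by move: nb; rewrite -Ej /= => ->.
    apply/negbTE/negP => ecj; case/orP: (onlyab _ pj ecj) => /eqP E.
      by move: (Up); rewrite cons_uniq => /andP[/negP N _]; case: N; rewrite -E mem_nth.
    have sj : j.+1 < size (a :: p) := jp.
    case/negP: nj; rewrite -(nth_eq_uniq a (c := a :: p)) //.
    by rewrite nb -E.
  rewrite !eqSS orbF.
  have i1 : nth a (a :: p) i \in S by apply: pS; rewrite mem_nth //=; lia.
  have j1 : nth a (a :: p) j \in S by apply: pS; rewrite mem_nth //=; lia.
  apply/idP/eqP => [eij|Ej].
    by apply: ind; rewrite /induced_rel /= ?i1 ?j1 //; lia.
  by rewrite Ej; apply: (pathP a pe); lia.
- by rewrite !in_set !mem_head in_cons mem_head orbT in_cons bp orbT.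
- apply/subsetP => x; rewrite in_set in_cons => /predU1P[->|/pS xS].
    exact: setU11.
  exact: setU1r.
- apply: connect_pathset pe lp _ => x xp; rewrite in_setD1 inE in_cons xp orbT andbT.
  by apply: contra cp => /eqP <-.
Qed.

(** Shortest paths from [u] to [x] through [A] and through [B] together contain a hole through [u].
    It has to use [x], the only link between the two sides once [u] is removed. *)
Lemma hole_of_two_sides (u x : T) (A B : {set T}) :
  induced_connected e A -> induced_connected e B ->
  (forall a b, a \in A -> b \in B -> (a != b) && ~~ e a b) ->
  u != x -> ~~ e u x -> u \notin A :|: B -> x \notin A :|: B ->
  (exists2 a, a \in A & e u a) -> (exists2 a, a \in A & e x a) ->
  (exists2 b, b \in B & e u b) -> (exists2 b, b \in B & e x b) ->
  exists H, [/\ is_hole e H, u \in H, x \in H & exists f, [&& f \in A, f \in H & e u f]].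
Proof.
move=> cA cB AB ux nux; rewrite !inE !negb_or => /andP[uA uB] /andP[xA xB] uA1 xA1 uB1 xB1.
(* [P] is a shortest path from [u] to [x] without its start; by minimality only its first vertex [a]
   is adjacent to [u]. *)
have side (C : {set T}) : induced_connected e C -> u \notin C -> x \notin C ->
    (exists2 a, a \in C & e u a) -> (exists2 a, a \in C & e x a) ->
    exists a (P : {set T}), [/\ a \in C, e u a, P \subset x |: C,
      {in P, forall y, e u y -> y = a} & connect (induced_rel P) a x].
  move=> cC uC xC [a aC eua] [b bC exb].
  have : connect (induced_rel ([set u] :|: C :|: [set x])) u x.
    have c1 := induced_connectedU (@induced_connected1 u) cC (set11 u) aC.
    rewrite eua orbT in c1.
    apply: (@induced_connectedU _ _ b x (c1 isT) (@induced_connected1 x)); rewrite ?inE ?eqxx ?bC ?orbT //.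
    by rewrite e_sym exb orbT.
  case/shortest_path => p [pp lp Up ind].
  have pe : path e u p by apply: sub_path pp => ? ? /and3P[].
  case: p => [|a1 p] /= in pp lp Up ind pe.
    by rewrite lp eqxx in ux.
  case/andP: pe => eua1 pe; case/andP: pp => /and3P[uS a1S _] pp.
  have up : u \notin a1 :: p by case/andP: Up.
  have pS : {subset a1 :: p <= x |: C}.
    have pS' : {subset a1 :: p <= [set u] :|: C :|: [set x]}.
      move=> z; rewrite inE => /predU1P[-> //|].
      elim: p a1 pp {up pe eua1 ind Up lp a1S} => //= w p IH y /andP[/and3P[_ wS _] pp].
      by rewrite inE => /predU1P[-> //|]; apply: IH pp.
    move=> z zp; have := pS' z zp; rewrite !inE => /orP[/orP[/eqP E|->]|->]; rewrite ?orbT //.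
    by rewrite -E zp in up.
  exists a1, [set z in a1 :: p]; split=> //.
  - have := pS a1 (mem_head _ _); rewrite !inE => /predU1P[E|//].
    by rewrite -E eua1 in nux.
  - by apply/subsetP => z; rewrite inE; apply: pS.
  - move=> y; rewrite inE => yp euy.
    have/(nthP u)[j jp Ej] := yp.
    have : j.+1 = 1.
      apply: (ind 0 j.+1); rewrite /induced_rel /= ?ltnS //.
      rewrite Ej euy uS !andbT /=.
      by have := pS y yp; rewrite !inE => /orP[->|->]; rewrite ?orbT.
    by case=> E; move: Ej; rewrite E.
  - by apply: connect_pathset pe lp _ => z; rewrite in_set.
have [a [P [aA eua PA onlya ca]]] := side A cA uA xA uA1 xA1.
have [b [Q [bB eub QB onlyb cb]]] := side B cB uB xB uB1 xB1.
have /andP[ab nab] := AB a b aA bB.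
have [|||H [hH /and3P[uH aH bH] HS cH]] := hole_through (S := P :|: Q) eua eub ab nab.
- rewrite inE negb_or; apply/andP; split.
    by apply/negP => /(subsetP PA); rewrite !inE (negbTE ux) (negbTE uA).
  by apply/negP => /(subsetP QB); rewrite !inE (negbTE ux) (negbTE uB).
- move=> y /setUP[/onlya yP|/onlyb yQ] euy; first by rewrite yP ?eqxx.
  by rewrite yQ ?eqxx ?orbT.
- apply: connect_trans (connect_induced_subset (subsetUl _ _) ca) _.
  by rewrite induced_rel_csym; apply: connect_induced_subset (subsetUr _ _) cb.
exists H; split=> //; last by exists a; rewrite aA aH eua.
(* If [H] missed [x], then [A] would be closed under the edges of [H] minus [u], so [a] could not be
   connected to [b] there. *)
apply/negPn/negP => xH.
have cl : closed (induced_rel (H :\ u)) (mem A).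
  apply: (intro_closed (induced_rel_csym (H :\ u))) => y z /and3P[_ zH eyz] yA.
  move: zH; rewrite !inE => /andP[zu zH].
  have := subsetP HS z zH; rewrite !inE (negbTE zu) /= => /orP[/(subsetP PA)|/(subsetP QB)].
    by rewrite !inE => /predU1P[E|//]; rewrite -E zH in xH.
  rewrite !inE => /predU1P[E|zB]; first by rewrite -E zH in xH.
  by have := AB y z yA zB; rewrite eyz andbF.
have /= := closed_connect cl cH; rewrite /= aA => /esym bA.
by have := AB b b bA bB; rewrite eqxx.
Qed.

End Connectivity.

(** * The arcs of a hole between two nonadjacent vertices *)

Section Arms.
Variables (T : finType) (e : rel T).
Hypotheses (e_sym : symmetric e) (e_irr : irreflexive e).

Definition segment (h : nat -> T) (l r : nat) : {set T} :=
  [set y in [seq h i | i <- iota l (r.+1 - l)]].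

Lemma segmentP h l r y : reflect (exists2 i, l <= i <= r & y = h i) (y \in segment h l r).
Proof.
rewrite in_set; apply: (iffP mapP) => -[i]; rewrite ?mem_iota => ir ->; exists i => //.
  by lia.
by rewrite mem_iota; lia.
Qed.

Lemma mem_segment h l r i : l <= i <= r -> h i \in segment h l r.
Proof. by move=> ir; apply/segmentP; exists i. Qed.

Lemma segment_connected h l r : (forall i, l <= i < r -> e (h i) (h i.+1)) ->
  induced_connected e (segment h l r).
Proof.
move=> step.
have cl i : l <= i <= r -> connect (induced_rel e (segment h l r)) (h l) (h i).
  elim: i => [|i IH] ir; first by have -> : l = 0 by lia.
  have [<-|ne] := eqVneq l i.+1; first exact: connect0.
  apply: connect_trans (IH _) _; first lia.
  by apply: connect1; rewrite /induced_rel /= !mem_segment ?step //; lia.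
move=> x y /segmentP[i ir ->] /segmentP[j jr ->].
apply: connect_trans (cl j jr); rewrite induced_rel_csym //; exact: cl.
Qed.

(** The last disjunct is the closing edge between positions [0] and [n.-1]. Indexing by a function
    turns arcs into [segment]s and reduces adjacency questions to linear arithmetic. *)
Definition hole_fun (h : nat -> T) (n : nat) : Prop :=
  [/\ 4 <= n, forall i j, i < n -> j < n -> (h i == h j) = (i == j)
    & forall i j, i < j < n -> e (h i) (h j) = (j == i.+1) || ((i == 0) && (j == n.-1))].

Lemma hole_seq_fun c x : hole_seq e c -> x \in c ->
  exists h n, [/\ hole_fun h n, h 0 = x & forall y, (y \in c) = (y \in segment h 0 n.-1)].
Proof.
move=> hc /rot_to[i s Ec].
have := hole_seq_rot i hc; rewrite Ec => /(hole_seq_nthP e_sym e_irr x)[Uc sc adj].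
exists (nth x (x :: s)), (size (x :: s)); split=> //; first by split=> // ? ? *; rewrite nth_eq_uniq.
move=> y; rewrite -(mem_rot i) Ec; apply/(mem_nthP x)/segmentP => -[j].
  by move=> js <-; exists j => //=; lia.
by move=> /= js ->; exists j => //=; lia.
Qed.

Lemma hole_fun_is_hole h n : hole_fun h n -> is_hole e (segment h 0 n.-1).
Proof.
case=> n4 inj adj; apply/is_holeP; exists (mkseq h n).
  apply/(hole_seq_nthP e_sym e_irr (h 0)); rewrite size_mkseq; split=> //.
    by apply/mkseq_uniqP => i j; rewrite !inE => ? ? /eqP; rewrite inj // => /eqP.
  by move=> i j ij; rewrite !nth_mkseq ?adj //; lia.
by apply/setP => y; rewrite !in_set /mkseq subn0 prednK //; lia.
Qed.

(* One of the two arcs of a hole H between nonadjacent u and x, starting at the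
   neighbour p of x; B is the arc with p removed and the end u added. *)
Record arm (u x : T) (H A B : {set T}) (p : T) : Prop := Arm {
  arm_sub : A \subset H :\ u :\ x;
  arm_mem : p \in A;
  arm_adj : e x p;
  arm_uniq : forall y, y \in A -> e x y -> y = p;
  arm_conn : induced_connected e A;
  arm_end : exists2 z, z \in A & e u z;
  arm_core : B \subset u |: (A :\ p);
  arm_core_mem : u \in B;
  arm_core_conn : induced_connected e B;
  arm_core_adj : exists2 z, z \in B & e p z }.

Lemma hole_arms H u x : is_hole e H -> u \in H -> x \in H -> u != x -> ~~ e u x ->
  exists A A' p B B' q, [/\ arm u x H A A' p, arm u x H B B' q &
    forall a b, a \in A -> b \in B -> (a != b) && ~~ e a b].
Proof.
case/is_holeP => c hc -> {H}; rewrite !in_set => uc xc ux nux.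
have [h [n [[n4 inj adj] h0 hP]]] := hole_seq_fun hc xc.
move: uc; rewrite hP => /segmentP[k kn Eu].
have H_ i : i < n -> h i \in [set x in c] by move=> ?; rewrite in_set hP mem_segment //; lia.
have k0 : k != 0 by apply: contraNneq ux => k0; rewrite Eu k0 h0.
move: nux; rewrite Eu -h0 e_sym adj; last lia.
rewrite negb_or eqxx /= => /andP[k1 kn1].
(* With [x] at position [0] and [u] at position [k], the arms are the two open arcs, nonempty
   because [k] is neither [1] nor [n.-1]. Each core drops the arm's end next to [x] and gains
   position [k]. *)
exists (segment h 1 k.-1), (segment h 2 k), (h 1), (segment h k.+1 n.-1), (segment h k n.-2), (h n.-1).
have step l r : r < n -> induced_connected e (segment h l r).
  by move=> rn; apply: segment_connected => i ir; rewrite adj; lia.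
split.
- split=> //.
  + apply/subsetP => y /segmentP[i ir ->]; rewrite in_setD1 in_setD1 !inj ?H_ //; lia.
  + by apply: mem_segment; lia.
  + by rewrite adj; lia.
  + move=> y /segmentP[i ir ->]; rewrite adj; last lia.
    by move=> E; congr h; lia.
  + by apply: step; lia.
  + by exists (h k.-1); [apply: mem_segment | rewrite e_sym adj]; lia.
  + apply/subsetP => y /segmentP[i ir ->]; rewrite in_setU1 in_setD1 !inj; try lia.
    case: eqVneq => //= ik; apply/andP; split; first lia.
    by apply: mem_segment; lia.
  + by apply: mem_segment; lia.
  + by apply: step; lia.
  + by exists (h 2); [apply: mem_segment | rewrite adj]; lia.
- split=> //.
  + apply/subsetP => y /segmentP[i ir ->]; rewrite in_setD1 in_setD1 !inj ?H_ //; lia.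
  + by apply: mem_segment; lia.
  + by rewrite adj; lia.
  + move=> y /segmentP[i ir ->]; rewrite adj; last lia.
    by move=> E; congr h; lia.
  + by apply: step; lia.
  + by exists (h k.+1); [apply: mem_segment | rewrite adj]; lia.
  + apply/subsetP => y /segmentP[i ir ->]; rewrite in_setU1 in_setD1 !inj; try lia.
    case: eqVneq => //= ik; apply/andP; split; first lia.
    by apply: mem_segment; lia.
  + by apply: mem_segment; lia.
  + by apply: step; lia.
  + by exists (h n.-2); [apply: mem_segment | rewrite e_sym adj]; lia.
- move=> a b /segmentP[i ir ->] /segmentP[j jr ->]; rewrite inj ?adj; lia.
Qed.

(* If F touched both arms, then A, F and B would connect the two neighbours of x
   on H, giving a hole that avoids u and follows both edges of H at x. *)
Lemma arm_avoiding u x H F : NC_vertex e u ->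
  is_hole e H -> u \in H -> x \in H -> u != x -> ~~ e u x ->
  induced_connected e F -> u \notin F ->
  (forall f, f \in F -> (f != x) && ~~ e x f) ->
  exists A A' p, arm u x H A A' p /\
    forall f a, f \in F -> a \in A -> (f != a) && ~~ e f a.
Proof.
move=> NCu hH uH xH ux nux cF uF Fx.
have [A [A' [p [B [B' [q [aA aB AB]]]]]]] := hole_arms hH uH xH ux nux.
case: (boolP [forall f in F, forall a in A, (f != a) && ~~ e f a]) => [ok|].
  exists A, A', p; split=> // f a fF aA'.
  by move/forall_inP: ok => /(_ f fF) /forall_inP; apply.
rewrite negb_forall_in => /exists_inP[f fF]; rewrite negb_forall_in => /exists_inP[a aA1].
rewrite negb_and !negbK => fa.
case: (boolP [forall f in F, forall a in B, (f != a) && ~~ e f a]) => [ok|].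
  exists B, B', q; split=> // f' b fF' bB'.
  by move/forall_inP: ok => /(_ f' fF') /forall_inP; apply.
rewrite negb_forall_in => /exists_inP[g gF]; rewrite negb_forall_in => /exists_inP[b bB].
rewrite negb_and !negbK => gb.
case: NCu.
have cAF : induced_connected e (A :|: F).
  by rewrite setUC; apply: (induced_connectedU e_sym cF (arm_conn aA) fF aA1).
have cS : induced_connected e (A :|: F :|: B).
  apply: (induced_connectedU e_sym cAF (arm_conn aB) (a := g) (b := b)) => //.
  by rewrite inE gF orbT.
have pA := arm_mem aA; have qB := arm_mem aB.
have /andP[pq npq] := AB p q pA qB.
have subH (C C' : {set T}) r y : arm u x H C C' r -> y \in C -> [&& y != x, y != u & y \in H].
  by move/arm_sub/subsetP => s /s; rewrite !inE.
(* [F] contains no neighbour of [x], so only [p] and [q] are adjacent to [x] in the union; the hole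
   found avoids [u] because [A], [F] and [B] all do. *)
have [|||H' [hH' /and3P[xH' pH' qH'] sub _]] :=
  hole_through e_sym e_irr (c := x) (a := p) (b := q) (S := A :|: F :|: B)
    (arm_adj aA) (arm_adj aB) pq npq.
- rewrite !inE !negb_or; apply/andP; split; last first.
    by apply/negP => /(subH _ _ _ _ aB); rewrite eqxx.
  apply/andP; split; first by apply/negP => /(subH _ _ _ _ aA); rewrite eqxx.
  by apply/negP => /Fx; rewrite eqxx.
- move=> y; rewrite !inE => /orP[/orP[yA|/Fx/andP[_ /negbTE ->]]|yB] // exy.
    by rewrite (arm_uniq aA yA exy) eqxx.
  by rewrite (arm_uniq aB yB exy) eqxx orbT.
- by apply: cS; rewrite !inE ?pA ?qB ?orbT.
exists H, H'; split=> //.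
  apply/negP => /(subsetP sub); rewrite !inE (negbTE ux) (negbTE uF) orbF /=.
  by case/orP => [/(subH _ _ _ _ aA)|/(subH _ _ _ _ aB)]; rewrite eqxx andbF.
exists p, x, q; split=> //.
- by rewrite e_sym (arm_adj aA).
- exact: arm_adj aB.
- case/and3P: (subH _ _ _ _ aA pA) => _ _ ->; case/and3P: (subH _ _ _ _ aB qB) => _ _ ->.
  by rewrite xH.
- by rewrite xH' pH' qH'.
Qed.

(* The new hole leaves u through F to d and returns through x along an arm of H
   that F does not touch. *)
Lemma second_hole u x d H F : NC_vertex e u ->
  is_hole e H -> u \in H -> x \in H -> u != x -> ~~ e u x ->
  induced_connected e F -> u \notin F ->
  (forall f, f \in F -> (f != x) && ~~ e x f) ->
  e x d -> u != d -> ~~ e u d ->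
  (exists2 f, f \in F & e d f) -> (exists2 f, f \in F & e u f) ->
  exists H', [/\ is_hole e H', u \in H', d \in H' & exists f, [&& f \in F, f \in H' & e u f]].
Proof.
move=> NCu hH uH xH ux nux cF uF Fx exd ud nud dF uF'.
have [A [A' [p [aA FA]]]] := arm_avoiding NCu hH uH xH ux nux cF uF Fx.
have pA := arm_mem aA.
have sub y : y \in A -> [&& y != x, y != u & y \in H].
  by move/(subsetP (arm_sub aA)); rewrite !inE.
apply: (hole_of_two_sides e_sym e_irr (B := [set x] :|: A) cF) => //.
- apply: (induced_connectedU e_sym (@induced_connected1 _ e x) (arm_conn aA) (set11 x) pA).
  by rewrite (arm_adj aA) orbT.
- move=> f b fF; rewrite !inE => /predU1P[->|bA]; last exact: FA.
  by rewrite e_sym; apply: Fx.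
- rewrite !inE (negbTE uF) (negbTE ux) /=.
  by apply/negP => /sub; rewrite eqxx andbF.
- rewrite !inE !negb_or; apply/and3P; split.
  + by apply/negP => /Fx; rewrite exd andbF.
  + by apply: contraTneq exd => ->; rewrite e_irr.
  + case: dF => f fF edf; apply/negP => dA.
    by have := FA f d fF dA; rewrite e_sym edf andbF.
- by case: (arm_end aA) => z zA uz; exists z; rewrite // inE zA orbT.
- by exists x; rewrite ?inE ?eqxx // e_sym.
Qed.

End Arms.

(** * Joining a vertex to everything on its holes *)

Section Fill.
Variables (T : finType) (e : rel T).
Hypotheses (e_sym : symmetric e) (e_irr : irreflexive e).

Definition fill (u : T) : rel T :=
  fun x y => e x y || [&& x != y, (x == u) || (y == u) & common_hole e x y].

Lemma common_hole_sym : symmetric (common_hole e).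
Proof.
by move=> x y; apply/common_holeP/common_holeP => -[H hH xy]; exists H; rewrite // andbC.
Qed.

Lemma fill_sym u : symmetric (fill u).
Proof. by move=> x y; rewrite /fill e_sym eq_sym common_hole_sym orbC (orbC (x == u)) orbC. Qed.

Lemma fill_irr u : irreflexive (fill u).
Proof. by move=> x; rewrite /fill e_irr eqxx. Qed.

Lemma fill_off u x y : x != u -> y != u -> fill u x y = e x y.
Proof. by rewrite /fill => /negbTE -> /negbTE ->; rewrite andbF orbF. Qed.

Lemma fill_at u y : y != u -> fill u u y = e u y || common_hole e u y.
Proof. by rewrite /fill eqxx eq_sym => ->. Qed.

(** Traversing the hole backwards from the same start exchanges positions [1] and [n.-1], so
    [fill_fun_adj] covers both edges at [u]. *)
Lemma hole_fun_rev (r : rel T) h n : symmetric r -> hole_fun r h n ->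
  hole_fun r (fun i => if i == 0 then h 0 else h (n - i)) n.
Proof.
move=> r_sym [n4 inj adj]; split=> // [[|i] [|j] ? ?|[|i] [|j] ij] //=; rewrite ?inj //; try lia.
  by rewrite adj; lia.
by rewrite r_sym adj; lia.
Qed.

(** If the edge from [u] to [h 1] were new, some hole of [e] would contain both, and [second_hole]
    would turn it into a hole of [e] through [u] and [h 2]. Then [fill] would join [u] to [h 2], a
    chord of the given hole. *)
Lemma fill_fun_adj u h n : NC_vertex e u -> hole_fun (fill u) h n -> h 0 = u ->
  e u (h 1).
Proof.
move=> NCu [n4 inj adj] h0; apply/negPn/negP => nu1.
have hu i : 0 < i < n -> h i != u by move=> ?; rewrite -h0 inj; lia.
have adje i j : 0 < i < j -> j < n -> e (h i) (h j) = (j == i.+1).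
  by move=> ij jn; rewrite -(@fill_off u) ?hu ?adj; lia.
have adju i : 0 < i < n -> e u (h i) || common_hole e u (h i) = (i == 1) || (i == n.-1).
  by move=> i_n; have := adj 0 i; rewrite h0 -fill_at ?hu // => ->; lia.
have := adju 1; rewrite (negbTE nu1) /= => /(_ ltac:(lia)) /common_holeP[H hH /andP[uH xH]].
have := adju 2; have -> : (2 == 1) || (2 == n.-1) = false by lia.
move=> /(_ ltac:(lia)) /negbT; rewrite negb_or => /andP[nu2 /common_holeP no2].
(* [F] must reach [u] by an edge of [e]. The path from [h 3] to [h n.-1] does so if its last vertex
   is an old neighbour of [u]; otherwise it is extended by an arm, untouched by [h 1], of a hole
   through [u] and [h n.-1]. *)
have [F [cF uF Fx dF uF']] : exists F : {set T}, [/\ induced_connected e F, u \notin F,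
    forall f, f \in F -> (f != h 1) && ~~ e (h 1) f,
    exists2 f, f \in F & e (h 2) f & exists2 f, f \in F & e u f].
  have cP : induced_connected e (segment h 3 n.-1).
    by apply: segment_connected => // i ir; rewrite adje; lia.
  have uP : u \notin segment h 3 n.-1.
    by apply/negP => /segmentP[i ir /eqP]; rewrite -h0 inj; lia.
  have Px f : f \in segment h 3 n.-1 -> (f != h 1) && ~~ e (h 1) f.
    by case/segmentP => i ir ->; rewrite inj ?adje; lia.
  have dP : exists2 f, f \in segment h 3 n.-1 & e (h 2) f.
    by exists (h 3); [apply: mem_segment | rewrite adje]; lia.
  have yP : h n.-1 \in segment h 3 n.-1 by apply: mem_segment; lia.
  have [uy|nuy] := boolP (e u (h n.-1)).
    by exists (segment h 3 n.-1); split=> //; exists (h n.-1).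
  have := adju n.-1; rewrite (negbTE nuy) eqxx orbT => /(_ ltac:(lia)).
  case/common_holeP => H' hH' /andP[uH' yH'].
  have [|||A [A' [p [aA xA]]]] := arm_avoiding e_sym e_irr NCu hH' uH' yH' _ nuy (@induced_connected1 _ e (h 1)).
  - by rewrite eq_sym hu; lia.
  - by rewrite inE eq_sym hu; lia.
  - by move=> f /set1P ->; rewrite inj 1?e_sym ?adje; lia.
  have sub y : y \in A -> [&& y != h n.-1, y != u & y \in H'].
    by move/(subsetP (arm_sub aA)); rewrite !inE.
  exists (segment h 3 n.-1 :|: A); split.
  - apply: (induced_connectedU e_sym cP (arm_conn aA) yP (arm_mem aA)).
    by rewrite (arm_adj aA) orbT.
  - by rewrite inE (negbTE uP); apply/negP => /sub; rewrite eqxx andbF.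
  - by move=> f /setUP[/Px //|/(xA (h 1) f (set11 _))]; rewrite eq_sym.
  - by case: dP => f fP; exists f; rewrite // inE fP.
  - by case: (arm_end aA) => z zA uz; exists z; rewrite // inE zA orbT.
have [||||||H' [hH' uH' dH' _]] := second_hole e_sym e_irr (d := h 2) NCu hH uH xH _ nu1 cF uF Fx.
- by rewrite eq_sym hu; lia.
- by rewrite adje; lia.
- by rewrite eq_sym hu; lia.
- by [].
- by [].
- by [].
by apply: no2; exists H'; rewrite ?uH'.
Qed.

(** If [u] were on [c], both edges at [u] would be old, so [c] would already be a hole of [e]; then
    [fill] would join [u] to [h 2], a chord. Away from [u] the two relations agree. *)
Lemma fill_hole_seq u c : NC_vertex e u -> hole_seq (fill u) c ->
  hole_seq e c /\ u \notin c.
Proof.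
move=> NCu hc; have [uc|uc] := boolP (u \in c).
  have [h [n [hh h0 _]]] := hole_seq_fun (@fill_sym u) (@fill_irr u) hc uc.
  have [n4 inj adj] := hh.
  have e1 := fill_fun_adj NCu hh h0.
  have e2 := fill_fun_adj NCu (hole_fun_rev (@fill_sym u) hh) h0; rewrite /= in e2.
  have hu i : 0 < i < n -> h i != u by move=> ?; rewrite -h0 inj; lia.
  have hhe : hole_fun e h n.
    split=> // -[|i] j ij; last by rewrite -adj // fill_off ?hu; lia.
    apply/idP/idP => [eh|]; first by rewrite -adj // /fill eh.
    have -> : n.-1 = n - 1 by lia.
    by rewrite h0; case/orP => /eqP ->.
  have : common_hole e u (h 2).
    apply/common_holeP; exists (segment h 0 n.-1); first exact: hole_fun_is_hole.
    by rewrite -{1}h0 !mem_segment //; lia.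
  have : fill u (h 0) (h 2) = false by rewrite adj; lia.
  have h2u : h 2 != u by apply: hu; lia.
  by rewrite h0 fill_at // => /negbT; rewrite negb_or => /andP[_ /negbTE ->].
split=> //.
have ne x : x \in c -> x != u by apply: contraTneq => ->.
case: c hc uc ne => // x0 c0; set c := x0 :: c0 => hc uc ne.
have [Uc sc adj] := (hole_seq_nthP (@fill_sym u) (@fill_irr u) x0 c).1 hc.
apply/(hole_seq_nthP e_sym e_irr x0); split=> // i j ij.
have ic : i < size c by lia.
have jc : j < size c by lia.
by rewrite -adj // fill_off //; apply: ne; apply: mem_nth.
Qed.

(** An [f]-edge inside the hole joins cyclic neighbours, and the cyclic order depends on the
    sequence alone, not on the relation. *)
Lemma hole_seq_edge (f : rel T) c x y : hole_seq f c -> hole_seq e c ->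
  x \in c -> y \in c -> f x y -> e x y.
Proof.
case/and4P=> _ _ _ chord /and4P[_ _ cc _] xc yc fxy.
move/allP: chord => /(_ _ xc) /allP /(_ _ yc); rewrite fxy => /orP[] /eqP ->.
  exact: next_cycle.
by rewrite e_sym; apply: prev_cycle.
Qed.

(** Keeps the property alive for a vertex still to be processed: holes that remain are old holes,
    and the edges they share are old edges. *)
Lemma NC_vertex_mono (f : rel T) u :
  (forall c, hole_seq f c -> hole_seq e c) -> NC_vertex e u -> NC_vertex f u.
Proof.
move=> fe NCu [H [H' [/is_holeP[c hc ->] /is_holeP[c' hc' ->] uH uH' share]]].
apply: NCu; exists [set x in c], [set x in c']; split=> //.
- by apply/is_holeP; exists c; first exact: fe.
- by apply/is_holeP; exists c'; first exact: fe.
case: share => x [y [z [xz fxy fyz inH inH']]]; exists x, y, z; split=> //.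
  by move: inH; rewrite !in_set => /and3P[xc yc zc]; apply: hole_seq_edge hc (fe _ hc) xc yc fxy.
by move: inH; rewrite !in_set => /and3P[xc yc zc]; apply: hole_seq_edge hc (fe _ hc) yc zc fyz.
Qed.

End Fill.

(** The tail of [s] is processed first, then its head by [NC_vertex_mono]. Since no hole is ever
    created, every added edge comes from a hole of the original [e]. *)
Lemma fill_all (T : finType) (e : rel T) (s : seq T) :
  symmetric e -> irreflexive e -> (forall u, u \in s -> NC_vertex e u) ->
  exists f : rel T, [/\ symmetric f, irreflexive f, subrel e f,
    forall x y, f x y -> e x y \/ common_hole e x y /\ (x \in s \/ y \in s)
    & forall c, hole_seq f c -> hole_seq e c /\ forall u, u \in s -> u \notin c].
Proof.
move=> e_sym e_irr; elim: s => [|u s IH] NCs.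
  by exists e; split=> // x y; left.
have [|f [f_sym f_irr ef fE fH]] := IH.
  by move=> v vs; apply: NCs; rewrite inE vs orbT.
have fe c : hole_seq f c -> hole_seq e c by case/fH.
have NCu : NC_vertex f u by apply: NC_vertex_mono fe (NCs u (mem_head _ _)).
exists (fill f u); split.
- exact: fill_sym.
- exact: fill_irr.
- by move=> x y exy; rewrite /fill ef.
- move=> x y; case/orP => [/fE[|[ch xy]]|/and3P[_ xy /common_holeP[H /is_holeP[c hc ->] inH]]].
  + by left.
  + by right; split=> //; case: xy => xs; [left|right]; rewrite inE xs orbT.
  + right; split; last first.
      by case/orP: xy => /eqP ->; [left|right]; rewrite mem_head.
    by apply/common_holeP; exists [set x in c] => //; apply/is_holeP; exists c => //; apply: fe.
- move=> c /(fill_hole_seq f_sym f_irr NCu)[hc uc]; have [hec sc] := fH c hc.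
  split=> // v; rewrite inE => /predU1P[-> //|]; exact: sc.
Qed.

Lemma is_cliqueP (T : finType) (e : rel T) (K : {set T}) :
  reflect {in K &, forall x y, x != y -> e x y} (is_clique e K).
Proof.
apply: (iffP forall_inP) => [cK x y xK yK xy|cK x xK].
  by move/forall_inP: (cK x xK) => /(_ y yK) /implyP; apply.
by apply/forall_inP => y yK; apply/implyP; apply: cK.
Qed.

(** * Components of induced subgraphs *)

Section Component.
Variables (T : finType) (e : rel T).
Hypotheses (e_sym : symmetric e) (e_irr : irreflexive e).

Definition component (W : {set T}) (b : T) : {set T} :=
  [set y | connect (induced_rel e W) b y].

Lemma component_sub (W : {set T}) b : b \in W -> component W b \subset W.
Proof.
move=> bW; apply/subsetP => y; rewrite inE => by_.
have cl : closed (induced_rel e W) (mem W).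
  by move=> x z /and3P[/= -> ->].
by have /= <- := closed_connect cl by_.
Qed.

Lemma component_refl W b : b \in component W b.
Proof. by rewrite inE connect0. Qed.

Lemma component_step (W : {set T}) b y z : b \in W ->
  y \in component W b -> z \in W -> e y z -> z \in component W b.
Proof.
move=> bW yD zW eyz; have yW := subsetP (component_sub bW) y yD.
move: yD; rewrite !inE => /connect_trans; apply; apply: connect1.
by rewrite /induced_rel /= yW zW.
Qed.

Lemma component_connected (W : {set T}) b : b \in W -> induced_connected e (component W b).
Proof.
move=> bW.
have cb y : y \in component W b -> connect (induced_rel e (component W b)) b y.
  rewrite inE => /connectP[p pp ->].
  apply: (connect_pathset (p := p)) => //.
    by apply: sub_path pp => ? ? /and3P[].
  by move=> z zp; rewrite inE; apply: path_connect pp _ zp.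
move=> x y /cb bx /cb; apply: connect_trans; by rewrite induced_rel_csym.
Qed.

End Component.

(** * Simplicial vertices of chordal graphs and greedy DP-colouring *)

Section Dirac.
Variables (T : finType) (f : rel T).
Hypotheses (f_sym : symmetric f) (f_irr : irreflexive f).
Hypothesis chordal : forall H, ~ is_hole f H.

Definition simplicial (S : {set T}) (v : T) : Prop :=
  {in S &, forall x y, f v x -> f v y -> x != y -> f x y}.

(* Dirac: in a component D of S minus N[a], the attachments of D form a clique Q,
   and a simplicial vertex of D :|: Q found inside D is simplicial in S. *)
Lemma simplicial_far (S : {set T}) a b : a \in S -> b \in S -> b != a -> ~~ f a b ->
  exists v, [/\ v \in S, v != a, ~~ f a v & simplicial S v].
Proof.
have [n] := ubnP #|S|; elim: n S a b => // n IH S a b Sn aS bS ba nab.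
pose W := [set y in S | (y != a) && ~~ f a y].
have bW : b \in W by rewrite inE bS ba nab.
have [D [DW bD cD Dstep]] : exists D : {set T}, [/\ D \subset W, b \in D,
    induced_connected f D & forall y z, y \in D -> z \in W -> f y z -> z \in D].
  exists (component f W b); split; [exact: component_sub | exact: component_refl
    | exact: component_connected | move=> y z; exact: component_step].
have inW y : y \in D -> [&& y \in S, y != a & ~~ f a y].
  by move/(subsetP DW); rewrite inE.
pose Q := [set q in S | f a q && [exists y in D, f y q]].
have ND y z : y \in D -> z \in S -> f y z -> z \in D :|: Q.
  move=> yD zS fyz; rewrite inE; case fa : (f a z); last first.
    rewrite (Dstep y z yD) // inE zS fa andbT.
    apply: contraTneq fyz => ->; rewrite f_sym.
    by case/and3P: (inW _ yD).
  by apply/orP; right; rewrite inE zS fa; apply/exists_inP; exists y.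
(* Two nonadjacent attachments, linked by a path through [D], would close to a hole through [a]. *)
have clQ : {in Q &, forall q r, q != r -> f q r}.
  move=> q r; rewrite !inE => /and3P[qS faq /exists_inP[y yD yq]].
  move=> /and3P[rS far /exists_inP[z zD zr]] qr; apply/negPn/negP => nqr.
  have [|||H [hH _ _ _]] := hole_through f_sym f_irr (S := [set q] :|: D :|: [set r]) faq far qr nqr.
  - rewrite !inE !negb_or; apply/andP; split; last by apply: contraTneq far => <-; rewrite f_irr.
    apply/andP; split; first by apply: contraTneq faq => <-; rewrite f_irr.
    by apply/negP => /inW; rewrite eqxx andbF.
  - move=> x; rewrite !inE => /orP[/orP[->//|/inW/and3P[_ _ /negbTE ->//]]|->]; by rewrite orbT.
  - have c1 : induced_connected f ([set q] :|: D).
      apply: (induced_connectedU f_sym (@induced_connected1 _ f q) cD (set11 q) yD).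
      by rewrite f_sym yq orbT.
    apply: (induced_connectedU f_sym c1 (@induced_connected1 _ f r) (a := z) (b := r)).
    + by rewrite inE zD orbT.
    + exact: set11.
    + by rewrite zr orbT.
    + by rewrite !inE eqxx.
    + by rewrite !inE eqxx orbT.
  exact: chordal hH.
have subS : D :|: Q \subset S.
  by apply/subsetP => y /setUP[/inW/andP[]//|]; rewrite inE => /andP[].
have small : #|D :|: Q| < n.
  rewrite -ltnS; apply: leq_trans _ Sn; rewrite ltnS; apply: proper_card.
  apply/properP; split=> //; exists a => //.
  rewrite !inE f_irr andbF orbF; by apply/negP => /inW; rewrite eqxx andbF.
have lift v : v \in D -> simplicial (D :|: Q) v ->
    exists v, [/\ v \in S, v != a, ~~ f a v & simplicial S v].
  move=> vD sv; exists v; case/and3P: (inW v vD) => vS va nav; split=> //.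
  by move=> x y xS yS vx vy; apply: sv (ND v x vD xS vx) (ND v y vD yS vy) vx vy.
(* The induction hypothesis yields a simplicial vertex different from [c] and not adjacent to it; as
   every vertex of [Q] is [c] or a neighbour of [c], it lies in [D]. *)
have far c v : c \in D :|: Q -> v \in D :|: Q -> v != c -> ~~ f c v ->
    (forall q, q \in Q -> (q == c) || f c q) ->
    exists v, [/\ v \in S, v != a, ~~ f a v & simplicial S v].
  move=> cU vU vc ncv Qc; have [w [wU wc ncw sw]] := IH _ c v small cU vU vc ncv.
  apply: lift sw; case/setUP: wU => // /Qc.
  by rewrite (negbTE wc) (negbTE ncw).
(* Take [c] in [Q] if some vertex of [Q] has a non-neighbour in [D :|: Q], else in [D] if possible.
   If neither exists, [D :|: Q] is a clique and [b] itself is simplicial. *)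
case: (boolP [exists q in Q, exists v in D :|: Q, (v != q) && ~~ f q v]).
  case/exists_inP=> q qQ /exists_inP[v vU /andP[vq nqv]].
  apply: (far q v) => //; first by rewrite inE qQ orbT.
  by move=> r rQ; case: eqVneq => //= rq; apply: clQ; rewrite // eq_sym.
rewrite negb_exists_in => /forall_inP allQ.
have Qall q v : q \in Q -> v \in D :|: Q -> v != q -> f q v.
  move=> qQ vU vq; have := allQ q qQ; rewrite negb_exists_in => /forall_inP /(_ v vU).
  by rewrite vq negbK.
case: (boolP [exists d in D, exists v in D :|: Q, (v != d) && ~~ f d v]).
  case/exists_inP=> d dD /exists_inP[v vU /andP[vd ndv]].
  apply: (far d v) => //; first by rewrite inE dD.
  move=> r rQ; case: eqVneq => //= rd; rewrite f_sym; apply: Qall; rewrite // 1?eq_sym //.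
  by rewrite inE dD.
rewrite negb_exists_in => /forall_inP allD.
apply: (lift b) => // x y xU yU _ _ xy.
case/setUP: xU => [xD|xQ]; last by apply: Qall; rewrite // eq_sym.
have := allD x xD; rewrite negb_exists_in => /forall_inP /(_ y yU).
by rewrite eq_sym xy negbK.
Qed.

Lemma simplicial_exists (S : {set T}) : S != set0 -> exists2 v, v \in S & simplicial S v.
Proof.
case/set0Pn=> a aS.
case: (boolP [exists c in S, exists b in S, (b != c) && ~~ f c b]).
  case/exists_inP=> c cS /exists_inP[b bS /andP[bc ncb]].
  by have [v [vS _ _ sv]] := simplicial_far cS bS bc ncb; exists v.
rewrite negb_exists_in => /forall_inP allS; exists a => // x y xS yS _ _ xy.
have := allS x xS; rewrite negb_exists_in => /forall_inP /(_ y yS).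
by rewrite eq_sym xy negbK.
Qed.

(** A vertex [v] simplicial for [f] is coloured last: with its [f]-neighbours in [S] it forms a
    clique, so they number less than [k], and each neighbour forbids at most one colour by the
    matching condition. *)
Lemma DP_colorable_chordal_super (e : rel T) k : symmetric e -> subrel e f -> 0 < k ->
  (forall K, is_clique f K -> #|K| <= k) -> DP_colorable e k.
Proof.
move=> e_symm ef k0 cl M [Msym Mfun].
suff col (S : {set T}) : exists g : T -> 'I_k,
    {in S &, forall u v, e u v -> ~~ M u v (g u) (g v)}.
  by have [g gP] := col setT; exists g => u v; apply: gP; rewrite inE.
have [n] := ubnP #|S|; elim: n S => // n IH S Sn.
have [->|S0] := eqVneq S set0.
  by exists (fun=> Ordinal k0) => u v; rewrite inE.
have [v vS sv] := simplicial_exists S0.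
have [|g gP] := IH (S :\ v).
  by move: Sn; rewrite (cardsD1 v) vS.
pose N := [set w in S | f v w].
have cN : #|N| < k.
  have vN : v \notin N by rewrite inE f_irr andbF.
  have := cl (v |: N); rewrite cardsU1 vN; apply.
  apply/is_cliqueP => x y xK yK xy.
  move: xK yK; rewrite !inE => /predU1P[xv|/andP[xS vx]] /predU1P[yv|/andP[yS vy]].
  - by rewrite xv yv eqxx in xy.
  - by rewrite xv.
  - by rewrite yv f_sym.
  - exact: sv.
pose bad := [set j : 'I_k | [exists w in N, e v w && M v w j (g w)]].
have cbad : #|bad| <= #|N|.
  (* Sending a bad colour to a neighbour that forbids it is injective, by the matching condition
     read from the neighbour's side. The default [v] is never reached on [bad]. *)
  pose pick_w j := odflt v [pick w in N | e v w && M v w j (g w)].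
  have pickP j : j \in bad -> [&& pick_w j \in N, e v (pick_w j) & M v (pick_w j) j (g (pick_w j))].
    rewrite inE /pick_w; case: pickP => [w //|no] /exists_inP[w wN ew].
    by have := no w; rewrite wN ew.
  rewrite -(card_in_imset (f := pick_w)).
    by apply/subset_leq_card/subsetP => w /imsetP[j /pickP/and3P[wN _ _] ->].
  move=> i j /pickP/and3P[_ e1 m1] /pickP/and3P[_ e2 m2] Eij.
  rewrite -Eij in m2; rewrite Msym in m1; rewrite Msym in m2.
  by rewrite e_symm in e1; exact: Mfun e1 m1 m2.
have [j jbad] : exists j, j \notin bad.
  apply/existsP; apply: contraTT cN => /existsPn noj; rewrite -leqNgt.
  apply: leq_trans cbad; rewrite -[X in X <= _]card_ord -cardsT; apply/subset_leq_card/subsetP => i _.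
  by have := noj i; rewrite negbK.
exists (fun w => if w == v then j else g w) => x y xS yS exy.
have ok w : w \in S -> e v w -> ~~ M v w j (g w).
  move=> wS evw; apply: contra jbad => m; rewrite inE; apply/exists_inP; exists w.
    by rewrite inE wS ef.
  by rewrite evw.
case: eqVneq => [xv|xv]; case: eqVneq => [yv|yv].
- by move/ef: exy; rewrite xv yv f_irr.
- by rewrite xv in exy *; apply: ok.
- by rewrite yv in exy *; rewrite Msym; apply: ok => //; rewrite e_symm.
- by apply: gP; rewrite // !inE ?xv ?yv.
Qed.

End Dirac.

(** * Complete minors, and cliques of the filled graph *)

Lemma has_K_minorW (T : finType) (e : rel T) m n :
  m <= n -> has_K_minor e n -> has_K_minor e m.
Proof.
move=> mn [B [B0 Bc Bd Ba]]; exists (fun i => B (widen_ord mn i)); split=> // i j ij.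
  by apply: Bd.
by apply: Ba.
Qed.

Section Cliques.
Variables (T : finType) (e : rel T).
Hypotheses (e_sym : symmetric e) (e_irr : irreflexive e).

Lemma near_clique_K_minor (K : {set T}) u : u \in K -> is_clique e (K :\ u) ->
  (forall w, w \in K :\ u -> e u w \/ common_hole e u w) -> has_K_minor e #|K|.
Proof.
move=> uK /is_cliqueP cK adj.
pose W := ~: (K :\ u).
have uW : u \in W by rewrite !inE eqxx.
have [C [CW uC cC CA]] : exists C : {set T}, [/\ C \subset W, u \in C,
    induced_connected e C & forall A : {set T}, induced_connected e (u |: A) ->
      A \subset W -> A \subset C].
  exists (component e W u); split; [exact: component_sub | exact: component_refl
    | exact: component_connected | move=> A cA AW].
  apply/subsetP => y yA; rewrite inE.
  apply: (@connect_induced_subset _ _ (u |: A)); first by rewrite subUset sub1set uW.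
  by apply: cA; rewrite !inE ?eqxx ?yA ?orbT.
have CK : [disjoint C & K :\ u] by rewrite disjoints_subset.
have reach w : w \in K :\ u -> exists2 c, c \in C & e c w.
  move=> wK; case euw : (e u w); first by exists u.
  have := adj w wK; rewrite euw => -[//|/common_holeP[H hH /andP[uH wH]]].
  have uw : u != w by case/setD1P: wK; rewrite eq_sym.
  have [A [A' [p [B [B' [q [aA aB AB]]]]]]] := hole_arms e_sym e_irr hH uH wH uw (negbT euw).
  (* A vertex of [K :\ u] on the arm would be adjacent to [w], hence equal to [r]. So if [r] is
     outside [K :\ u], the whole arm is, and it joins [r] to [u] inside [C]. *)
  have go (D D' : {set T}) r : arm e u w H D D' r -> r \notin K :\ u ->
      exists2 c, c \in C & e c w.
    move=> aD rK; exists r; last by rewrite e_sym (arm_adj aD).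
    apply: (subsetP (CA D _ _)); last exact: arm_mem aD.
      have [z zD euz] := arm_end aD.
      apply: (induced_connectedU e_sym (@induced_connected1 _ e u) (arm_conn aD) (set11 u) zD).
      by rewrite euz orbT.
    apply/subsetP => y yD; rewrite inE; apply: contra rK => yK.
    rewrite -(arm_uniq aD yD) //; apply: cK => //.
    by have := subsetP (arm_sub aD) y yD; rewrite !inE eq_sym => /andP[].
  have [pK|pK] := boolP (p \in K :\ u); last exact: go aA pK.
  have [qK|qK] := boolP (q \in K :\ u); last exact: go aB qK.
  (* Both neighbours of [w] on the hole cannot be in the clique [K :\ u]: they would be adjacent. *)
  have /andP[pq npq] := AB p q (arm_mem aA) (arm_mem aB).
  by rewrite cK in npq.
pose B (i : 'I_#|K|) := if enum_val i == u then C else [set enum_val i].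
have inK (i : 'I_#|K|) : enum_val i != u -> enum_val i \in K :\ u.
  by move=> iu; rewrite !inE iu enum_valP.
exists B; split.
- move=> i; rewrite /B; case: ifP => _; apply/set0Pn; first by exists u.
  by exists (enum_val i); apply: set11.
- by move=> i; rewrite /B; case: ifP => _ //; apply: induced_connected1.
- move=> i j ij; rewrite /B.
  have ne : enum_val i != enum_val j by rewrite (inj_eq enum_val_inj).
  case: (eqVneq (enum_val i) u) => [iu|iu]; case: (eqVneq (enum_val j) u) => [ju|ju].
  + by rewrite iu ju eqxx in ne.
  + by rewrite disjoint_sym disjoints1 (disjointFl CK (inK _ ju)).
  + by rewrite disjoints1 (disjointFl CK (inK _ iu)).
  + by rewrite disjoints1 inE.
- move=> i j ij; rewrite /B.
  have ne : enum_val i != enum_val j by rewrite (inj_eq enum_val_inj).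
  case: (eqVneq (enum_val i) u) => [iu|iu]; case: (eqVneq (enum_val j) u) => [ju|ju].
  + by rewrite iu ju eqxx in ne.
  + have [c cC' ecj] := reach _ (inK _ ju).
    by exists c, (enum_val j); rewrite set11.
  + have [c cC' ecj] := reach _ (inK _ iu).
    by exists (enum_val i), c; rewrite set11 e_sym.
  + exists (enum_val i), (enum_val j); rewrite !set11; split=> //.
    by apply: cK; rewrite // inK.
Qed.

Variable X : {set T}.
Hypothesis NCX : NC_set e X.

Lemma hole_meets_once H u v :
  is_hole e H -> u \in X -> v \in X -> u \in H -> v \in H -> u = v.
Proof.
move=> /NCX.2 /card_le1_eqP c1 uX vX uH vH.
by apply: c1; rewrite inE ?uX ?uH ?vX ?vH.
Qed.

(** Some arm of [H'] between [u'] and [w] is not touched by [u]. Routing through its core,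
    [second_hole] gives a hole that leaves [u] by a vertex of the core; the only possible one is
    [u'], so this hole contains two vertices of [X]. *)
Lemma no_common_far_vertex u u' w : u \in X -> u' \in X -> e u u' ->
  u != w -> u' != w -> ~~ e u w -> ~~ e u' w ->
  common_hole e u w -> common_hole e u' w -> False.
Proof.
move=> uX uX' uu' uw uw' nuw nuw' /common_holeP[H hH /andP[uH wH]].
case/common_holeP=> H' hH' /andP[uH' wH'].
have neq : u != u' by apply: contraTneq uu' => ->; rewrite e_irr.
have [||A [B [p [aA uA]]]] := arm_avoiding e_sym e_irr (NCX.1 _ uX') hH' uH' wH' uw' nuw'
  (@induced_connected1 _ e u).
- by rewrite inE eq_sym.
- by move=> f /set1P ->; rewrite uw e_sym.
have {}uA a : a \in A -> (u != a) && ~~ e u a by apply: uA; apply: set11.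
have inB y : y \in B -> y = u' \/ (y \in A) && (y != p).
  move/(subsetP (arm_core aA)); rewrite !inE => /orP[/eqP ->|/andP[yp yA]]; first by left.
  by right; rewrite yp yA.
have /andP[up nup] := uA p (arm_mem aA).
have [||||H2 [hH2 uH2 _ [f /and3P[fB fH uf]]]] := second_hole e_sym e_irr (d := p) (NCX.1 _ uX)
  hH uH wH uw nuw (arm_core_conn aA) _ _ (arm_adj aA) up nup.
- by apply/negP => /inB[E|/andP[/uA]]; [rewrite E eqxx in neq | rewrite eqxx].
- move=> f /inB[->|/andP[fA fp]]; first by rewrite uw' e_sym.
  have := subsetP (arm_sub aA) f fA; rewrite !inE => /and3P[-> _ _] /=.
  by apply: contra fp => /(arm_uniq aA fA) ->.
- exact: arm_core_adj aA.
- by exists u' => //; apply: arm_core_mem aA.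
case: (inB f fB) => [E|/andP[/uA]]; last by rewrite uf andbF.
case/eqP: neq; apply: (hole_meets_once hH2) => //.
by rewrite -E.
Qed.

Variable f : rel T.
Hypothesis fE : forall x y, f x y -> e x y \/ common_hole e x y /\ (x \in X \/ y \in X).

(** Remove the end [u] in [X] of a new edge [u w]. Another new edge [u' w'] avoiding [u] would have
    [u'] adjacent to [u], and [no_common_far_vertex] makes [u' w] and [u w'] edges of [e], which
    leads to a hole meeting [X] twice. *)
Lemma near_clique (K : {set T}) : K != set0 -> is_clique f K ->
  exists2 u, u \in K & is_clique e (K :\ u).
Proof.
move=> K0 /is_cliqueP fK.
(* A missing edge has exactly one end in [X]: its ends share a hole, which has at most one vertex in
   [X]. *)
have bad (L : {set T}) : L \subset K -> ~~ is_clique e L ->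
    exists u w, [/\ u \in L :&: X, w \in L :\: X, u != w, ~~ e u w & common_hole e u w].
  move=> /subsetP LK; rewrite negb_forall_in => /exists_inP[x xL].
  rewrite negb_forall_in => /exists_inP[y yL]; rewrite negb_imply => /andP[xy nxy].
  have := fE (fK _ _ (LK _ xL) (LK _ yL) xy); rewrite (negbTE nxy) => -[//|[ch inX]].
  have notboth : ~ (x \in X /\ y \in X).
    case/common_holeP: ch => H hH /andP[xH yH] [xX yX].
    by case/eqP: xy; apply: hole_meets_once hH xX yX xH yH.
  case: inX => inX; [exists x, y|exists y, x]; rewrite !inE xL yL inX !andbT.
    by split=> //; apply/negP => yX; apply: notboth.
  by split; rewrite // ?(eq_sym y) 1?e_sym 1?common_hole_sym //; apply/negP => yX; apply: notboth.
have [cK|/(bad _ (subxx K))] := boolP (is_clique e K).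
  have [u uK] := set0Pn _ K0; exists u => //.
  move/is_cliqueP: cK => cK; apply/is_cliqueP => x y /setD1P[_ xK] /setD1P[_ yK].
  exact: cK.
case=> u [w [/setIP[uK uX] /setDP[wK wX] uw nuw chuw]].
exists u => //; apply/negPn/negP => /(bad _ (subsetDl K [set u])).
case=> u' [w' [/setIP[/setD1P[u'u u'K] u'X] /setDP[/setD1P[w'u w'K] w'X] u'w' nu'w' chu'w']].
have euu' : e u u'.
  case: (fE (fK u u' uK u'K _)); rewrite 1?eq_sym // => -[/common_holeP[H hH /andP[uH u'H]] _].
  by case/eqP: u'u; apply: hole_meets_once hH u'X uX u'H uH.
have u'w : u' != w by apply: contraNneq wX => <-.
have [eu'w|nu'w] := boolP (e u' w); last first.
  apply: (no_common_far_vertex uX u'X euu' uw u'w nuw nu'w chuw).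
  by case: (fE (fK _ _ u'K wK u'w)) => [E|[]//]; rewrite E in nu'w.
have [euw'|nuw'] := boolP (e u w'); last first.
  have uw' : u != w' by rewrite eq_sym.
  apply: (no_common_far_vertex uX u'X euu' uw' u'w' nuw' nu'w' _ chu'w').
  by case: (fE (fK _ _ uK w'K uw')) => [E|[]//]; rewrite E in nuw'.
(* Otherwise u, u', w, w' is a hole of length 4 through two vertices of X. *)
have ww' : w != w' by apply: contraNneq nu'w' => <-.
have eww' : e w w'.
  case: (fE (fK _ _ wK w'K ww')) => // -[_ []]; by [rewrite (negbTE wX) | rewrite (negbTE w'X)].
have [|||H [hH /and3P[uH u'H _] _ _]] := hole_through e_sym e_irr (c := u) (a := u') (b := w')
  (S := [set u'; w; w']) euu' euw' u'w' nu'w'.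
- by rewrite !inE !negb_or uw andbT eq_sym u'u eq_sym w'u.
- by move=> y; rewrite !inE => /orP[/orP[->//|/eqP ->]|->]; rewrite ?orbT // (negbTE nuw).
- apply: (@connect_trans _ _ w); apply: connect1; rewrite /induced_rel /= !inE !eqxx ?orbT //=.
by case/eqP: u'u; apply: hole_meets_once hH u'X uX u'H uH.
Qed.

End Cliques.

Theorem theorem1 (T : finType) (e : rel T) :
  simple_graph e -> NC_graph e ->
  chi_DP_le e (omega e).+1 /\
  (forall n : nat, ~ has_K_minor e n -> chi_DP_le e (n - 1)).
Proof.
move=> [e_sym e_irr] [X [[X0 cover] NCX]].
have [|f [f_sym f_irr ef fE fH]] := fill_all (s := enum X) e_sym e_irr.
  by move=> u; rewrite mem_enum; apply: NCX.1.
(* A hole of [f] would be a hole of [e] disjoint from the cover [X]. *)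
have chordal H : ~ is_hole f H.
  move=> /is_holeP[c /fH[hc avoid] _].
  have /set0Pn[u] : [set x in c] :&: X != set0 by apply: cover; apply/is_holeP; exists c.
  by rewrite !inE => /andP[uc uX]; have := avoid u; rewrite mem_enum uc => /(_ uX).
have {}fE x y : f x y -> e x y \/ common_hole e x y /\ (x \in X \/ y \in X).
  by move/fE; rewrite !mem_enum.
have near K : K != set0 -> is_clique f K -> #|K| <= (omega e).+1 /\ has_K_minor e #|K|.
  move=> K0 fK; have [u uK cK] := near_clique e_sym e_irr NCX fE K0 fK.
  split.
    by rewrite (cardsD1 u) uK add1n ltnS /omega; rewrite (bigD1 (K :\ u)) //= leq_maxl.
  apply: (near_clique_K_minor e_sym e_irr uK cK) => w /setD1P[wu wK].
  have := is_cliqueP _ _ fK u w uK wK; rewrite eq_sym => /(_ wu).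
  by case/fE => [|[]]; [left|right].
split.
  exists (omega e).+1 => //; apply: (DP_colorable_chordal_super f_sym f_irr chordal e_sym ef) => //.
  by move=> K cK; have [->|K0] := eqVneq K set0; [rewrite cards0 | case: (near K K0 cK)].
move=> n nominor; exists (n - 1) => //.
have small K : K != set0 -> is_clique f K -> #|K| < n.
  move=> K0 cK; rewrite ltnNge; apply/negP => nK; apply: nominor.
  by apply: has_K_minorW nK _; case: (near K K0 cK).
(* The nonempty cover provides a vertex, so [n - 1] is not truncated and the palette is nonempty. *)
have n1 : 1 < n.
  have [x _] := set0Pn _ X0; rewrite -(cards1 x); apply: small.
    by apply/set0Pn; exists x; apply: set11.
  by apply/is_cliqueP => a b /set1P -> /set1P ->; rewrite eqxx.
apply: (DP_colorable_chordal_super f_sym f_irr chordal e_sym ef) => //; first by lia.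
move=> K cK; have [->|K0] := eqVneq K set0; first by rewrite cards0.
by have := small K K0 cK; lia.
Qed.
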